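(* Let $(\mathcal{C},\mathbb{E},\mathfrak{s})$ and $(\mathcal{D},\mathbb{F},\mathfrak{t})$ be essentially small extriangulated categories, and let $(S:\mathcal{D}\to\mathcal{C},\,T:\mathcal{C}\to\mathcal{D})$ be an adjoint pair, with unit $\varphi:1_{\mathcal{D}}\to T\circ S$ and co-unit $\psi:S\circ T\to1_{\mathcal{C}}$, such that $T$ and $S$ are extriangulated. For $n\geq1$ consider the natural transformations $\tau^n:\mathbb{E}^n(S(?),-)\to\mathbb{F}^n(?,T(-))$ and $\sigma^n:\mathbb{F}^n(?,T(-))\to\mathbb{E}^n(S(?),-)$ induced by the maps $$\tau^n_{D,C}:\mathbb{E}^n(SD,C)\to\mathbb{F}^n(D,TC),\ \eta\mapsto\Gamma_T^n(\eta)\cdot\varphi_D,\qquad\sigma^n_{D,C}:\mathbb{F}^n(D,TC)\to\mathbb{E}^n(SD,C),\ \eta\mapsto\psi_C\cdot\Gamma_S^n(\eta).$$ Then the following statements hold true. (a) If $\varphi:1\to T\circ S$ is extriangulated, then $\sigma^n$ is a split-mono and $\tau^n$ is a split-epi. (b) If $\psi:S\circ T\to1$ is extriangulated, then $\tau^n$ is a split-mono and $\sigma^n$ is a split-epi. (c) If $\varphi:1\to T\circ S$ and $\psi:S\circ T\to1$ are extriangulated, then $\tau^n$ is an isomorphism whose inverse is $\sigma^n$.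
   Context: **Extriangulated categories (Nakaoka–Palu).** An extriangulated category is a triple $(\mathcal{C},\mathbb{E},\mathfrak{s})$: $\mathcal{C}$ is an additive category, $\mathbb{E}:\mathcal{C}^{op}\times\mathcal{C}\to\mathrm{Ab}$ is an additive bifunctor (for $\delta\in\mathbb{E}(C,A)$, $a:A\to A'$, $c:C'\to C$ write $a\cdot\delta=\mathbb{E}(C,a)(\delta)$, $\delta\cdot c=\mathbb{E}(c,A)(\delta)$; the same notation is used for $\mathbb{E}^n$), and $\mathfrak{s}$ assigns to each $\delta\in\mathbb{E}(C,A)$ an equivalence class $\mathfrak{s}(\delta)=[A\xrightarrow{x}B\xrightarrow{y}C]$ (two sequences are equivalent if there is an isomorphism of middle terms compatible with the identities of $A$ and $C$), subject to: (i) $\mathfrak{s}(0)=[A\to A\oplus C\to C]$ (canonical maps) and $\mathfrak{s}(\delta\oplus\delta')=\mathfrak{s}(\delta)\oplus\mathfrak{s}(\delta')$; (ii) if $\mathfrak{s}(\delta)=[A\xrightarrow{x}B\xrightarrow{y}C]$, $\mathfrak{s}(\delta')=[A'\xrightarrow{x'}B'\xrightarrow{y'}C']$ and $a:A\to A'$, $c:C\to C'$ satisfy $a\cdot\delta=\delta'\cdot c$, there is $b:B\to B'$ with $bx=x'a$, $y'b=cy$; (iii) (ET3) in the same notation, if $bx=x'a$ there is $c$ with $cy=y'b$ and $a\cdot\delta=\delta'\cdot c$, and dually (ET3$^{op}$); (iv) (ET4) if $\mathfrak{s}(\delta)=[A\xrightarrow{f}B\xrightarrow{f'}D]$ and $\mathfrak{s}(\delta')=[B\xrightarrow{g}C\xrightarrow{g'}F]$,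 there are $\delta''\in\mathbb{E}(E,A)$ with $\mathfrak{s}(\delta'')=[A\xrightarrow{gf}C\xrightarrow{h'}E]$ and morphisms $d:D\to E$, $e:E\to F$ with $df'=h'g$, $eh'=g'$, $\mathfrak{s}(f'\cdot\delta')=[D\xrightarrow{d}E\xrightarrow{e}F]$, $\delta''\cdot d=\delta$, $f\cdot\delta''=\delta'\cdot e$, and dually (ET4$^{op}$). **Extriangulated functors and transformations.** A functor $F:(\mathcal{C},\mathbb{E},\mathfrak{s})\to(\mathcal{D},\mathbb{F},\mathfrak{t})$ is extriangulated if it is additive and equipped with a natural transformation $\Gamma_F:\mathbb{E}(-,?)\to\mathbb{F}(F-,F?)$ such that if $\mathfrak{s}(\eta)=[A\xrightarrow{f}B\xrightarrow{g}C]$ then $\mathfrak{t}(\Gamma_F(\eta))=[FA\xrightarrow{Ff}FB\xrightarrow{Fg}FC]$. Composites carry $\Gamma_{G\circ F}=\Gamma_G\circ\Gamma_F$, and identities carry the identity. A natural transformation $\alpha:F\to H$ of extriangulated functors is extriangulated if $\alpha_B\cdot\Gamma_F(\eta)=\Gamma_H(\eta)\cdot\alpha_A$ for all $\eta\in\mathbb{E}(A,B)$. **Higher extensions.** For an essentially small extriangulated category, with $|\mathcal{C}|$ a set of representatives of iso-classes of objects, put $\mathbb{E}^1=\mathbb{E}$ and let $\mathbb{E}^{n+1}(A,B)$ be the quotient of $\bigoplus_{C\in|\mathcal{C}|}\mathbb{E}(C,B)\otimes_{\mathbb{Z}}\mathbb{E}^n(A,C)$ by the subgroup generated by all $(\epsilon\cdot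 f)\otimes\epsilon'-\epsilon\otimes(f\cdot\epsilon')$ with $\epsilon\in\mathbb{E}(C,B)$, $\epsilon'\in\mathbb{E}^n(A,C')$, $f:C'\to C$. Every element of $\mathbb{E}^{i+j}(A,B)$ can be written as a product $\epsilon\cdot\epsilon'$ with $\epsilon\in\mathbb{E}^i(C,B)$, $\epsilon'\in\mathbb{E}^j(A,C)$. An extriangulated functor $F$ induces natural transformations $\Gamma_F^k:\mathbb{E}^k(-,?)\to\mathbb{F}^k(F-,F?)$, $k\geq1$, with $\Gamma_F^1=\Gamma_F$ and $\Gamma_F^{i+j}(\epsilon\cdot\epsilon')=\Gamma_F^i(\epsilon)\cdot\Gamma_F^j(\epsilon')$. *)

(* Defs.v *)
From HB Require Import structures.
From mathcomp Require Import all_boot all_algebra.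
From mathcomp Require Import generic_quotient ring_quotient.
From mathcomp Require Import boolp freeg.

Set Implicit Arguments.
Unset Strict Implicit.
Unset Printing Implicit Defensive.

Import GRing.Theory.
Local Open Scope quotient_scope.
Local Open Scope ring_scope.

Declare Scope cat_scope.
Delimit Scope cat_scope with cat.
Local Open Scope cat_scope.

Reserved Notation "g \c f" (at level 40, left associativity).
Reserved Notation "f *> e" (at level 41, right associativity).
Reserved Notation "e <* f" (at level 40, left associativity).

Record preadd := Preadd {
  ob :> Type;
  hom : ob -> ob -> zmodType;
  idm : forall A, hom A A;
  comp : forall A B C, hom B C -> hom A B -> hom A C;
  comp1m : forall A B (f : hom A B), comp (idm B) f = f;
  compm1 : forall A B (f : hom A B), comp f (idm A) = f;
  compA : forall A B C D (h : hom C D) (g : hom B C) (f : hom A B),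
    comp h (comp g f) = comp (comp h g) f;
  compDl : forall A B C (g g' : hom B C) (f : hom A B),
    comp (g + g') f = comp g f + comp g' f;
  compDr : forall A B C (g : hom B C) (f f' : hom A B),
    comp g (f + f') = comp g f + comp g f'
}.
Arguments hom {p} A B.
Arguments idm {p} A.
Arguments comp {p A B C} g f.
Notation "g \c f" := (comp g f) : cat_scope.

Definition inverse_pair (X : preadd) (A B : X) (f : hom A B) (g : hom B A) :=
  g \c f = idm A /\ f \c g = idm B.

Definition is_iso (X : preadd) (A B : X) (f : hom A B) :=
  exists g : hom B A, inverse_pair f g.

Definition isomorphic (X : preadd) (A B : X) := exists f : hom A B, is_iso f.

Definition is_zero_object (X : preadd) (Z : X) :=
  forall A : X, (forall f : hom Z A, f = 0) /\ (forall f : hom A Z, f = 0).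

Record biproduct (X : preadd) (A B : X) := Biproduct {
  bsum :> X;
  in1 : hom A bsum;
  in2 : hom B bsum;
  pr1 : hom bsum A;
  pr2 : hom bsum B;
  pr1_in1 : pr1 \c in1 = idm A;
  pr2_in2 : pr2 \c in2 = idm B;
  pr1_in2 : pr1 \c in2 = 0;
  pr2_in1 : pr2 \c in1 = 0;
  in_pr : in1 \c pr1 + in2 \c pr2 = idm bsum
}.

Record addcat := Addcat {
  addcat_preadd :> preadd;
  has_zero_object : exists Z : addcat_preadd, is_zero_object Z;
  has_biproducts : forall A B : addcat_preadd, inhabited (biproduct A B)
}.

Definition hom_sum (X : preadd) (A B A' B' : X)
    (P : biproduct A A') (Q : biproduct B B')
    (f : hom A B) (f' : hom A' B') : hom P Q :=
  in1 Q \c f \c pr1 P + in2 Q \c f' \c pr2 P.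

Record functor (X Y : preadd) := Functor {
  fo :> X -> Y;
  fm : forall A B : X, hom A B -> hom (fo A) (fo B);
  fm1 : forall A, fm (idm A) = idm (fo A);
  fmM : forall A B C (g : hom B C) (f : hom A B), fm (g \c f) = fm g \c fm f;
  fmD : forall A B (f f' : hom A B), fm (f + f') = fm f + fm f'
}.
Arguments fm {X Y} F {A B} f : rename.

Definition functor_id (X : preadd) : functor X X.
Proof. by exists id (fun _ _ f => f). Defined.

Definition functor_comp (X Y Z : preadd) (G : functor Y Z) (F : functor X Y) :
  functor X Z.
Proof.
exists (fun A => G (F A)) (fun _ _ f => fm G (fm F f)).
- by move=> A; rewrite !fm1.
- by move=> A B C g f; rewrite !fmM.
- by move=> A B f f'; rewrite !fmD.
Defined.

Record nattrans (X Y : preadd) (F G : functor X Y) := Nattrans {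
  nt :> forall A : X, hom (F A) (G A);
  nt_nat : forall A B (f : hom A B), nt B \c fm F f = fm G f \c nt A
}.

Record bif (X Y : preadd) := Bif {
  bo :> X -> Y -> zmodType;
  pull : forall A A' B, bo A B -> hom A' A -> bo A' B;
  push : forall A B B', hom B B' -> bo A B -> bo A B';
  pullD : forall A A' B (e e' : bo A B) (f : hom A' A),
    pull (e + e') f = pull e f + pull e' f;
  pushD : forall A B B' (f : hom B B') (e e' : bo A B),
    push f (e + e') = push f e + push f e';
  pullDr : forall A A' B (e : bo A B) (f f' : hom A' A),
    pull e (f + f') = pull e f + pull e f';
  pushDl : forall A B B' (f f' : hom B B') (e : bo A B),
    push (f + f') e = push f e + push f' e;
  pull1 : forall A B (e : bo A B), pull e (idm A) = e;
  push1 : forall A B (e : bo A B), push (idm B) e = e;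
  pullM : forall A A' A'' B (e : bo A B) (f : hom A' A) (g : hom A'' A'),
    pull e (f \c g) = pull (pull e f) g;
  pushM : forall A B B' B'' (g : hom B' B'') (f : hom B B') (e : bo A B),
    push (g \c f) e = push g (push f e);
  push_pull : forall A A' B B' (f : hom B B') (e : bo A B) (g : hom A' A),
    push f (pull e g) = pull (push f e) g
}.
Arguments pull {X Y} E {A A' B} e f : rename.
Arguments push {X Y} E {A B B'} f e : rename.
Notation "f *> e" := (push _ f e) : cat_scope.
Notation "e <* f" := (pull _ e f) : cat_scope.

Definition bif_reindex (X X' Y Y' : preadd) (F : functor X' X)
  (G : functor Y' Y) (E : bif X Y) : bif X' Y'.
Proof.
exists (fun A B => E (F A) (G B)) (fun _ _ _ e f => e <* fm F f)
       (fun _ _ _ f e => fm G f *> e).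
- by move=> *; rewrite pullD.
- by move=> *; rewrite pushD.
- by move=> *; rewrite fmD pullDr.
- by move=> *; rewrite fmD pushDl.
- by move=> *; rewrite fm1 pull1.
- by move=> *; rewrite fm1 push1.
- by move=> *; rewrite fmM pullM.
- by move=> *; rewrite fmM pushM.
- by move=> *; rewrite push_pull.
Defined.

(* natural transformations of functors with values in abelian groups: the
   components are group homomorphisms *)
Record btrans (X Y : preadd) (G H : bif X Y) := Btrans {
  bt :> forall A B, G A B -> H A B;
  btD : forall A B (e e' : G A B), bt (e + e') = bt e + bt e';
  bt_pull : forall A A' B (e : G A B) (f : hom A' A), bt (e <* f) = bt e <* f;
  bt_push : forall A B B' (f : hom B B') (e : G A B), bt (f *> e) = f *> bt e
}.
Arguments bt {X Y G H} m {A B} e : rename.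

Definition btrans_retraction (X Y : preadd) (G H : bif X Y)
    (m : btrans G H) (r : btrans H G) :=
  forall A B (e : G A B), bt r (bt m e) = e.

Definition split_mono (X Y : preadd) (G H : bif X Y) (m : btrans G H) :=
  exists r : btrans H G, btrans_retraction m r.

Definition split_epi (X Y : preadd) (G H : bif X Y) (p : btrans G H) :=
  exists s : btrans H G, btrans_retraction s p.

Definition btrans_inverse (X Y : preadd) (G H : bif X Y)
    (m : btrans G H) (m' : btrans H G) :=
  btrans_retraction m m' /\ btrans_retraction m' m.

Record sequence (X : preadd) (A C : X) := Sequence {
  mid : X;
  seq_in : hom A mid;
  seq_out : hom mid C
}.
Arguments Sequence {X A C} mid seq_in seq_out.

Definition seq_equiv (X : preadd) (A C : X) (s t : sequence A C) :=
  exists b : hom (mid s) (mid t),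
    [/\ is_iso b, b \c seq_in s = seq_in t & seq_out t \c b = seq_out s].

Definition seq_sum (X : preadd) (A C A' C' : X) (s : sequence A C)
    (s' : sequence A' C') (PA : biproduct A A')
    (PM : biproduct (mid s) (mid s')) (PC : biproduct C C') :
    sequence PA PC :=
  Sequence PM (hom_sum PA PM (seq_in s) (seq_in s'))
              (hom_sum PM PC (seq_out s) (seq_out s')).

Arguments seq_sum {X A C A' C'} s s' PA PM PC.

(* the image of [(e, e')] under [E(C,A) x E(C',A') -> E(C (+) C', A (+) A')] *)
Definition bif_sum (X : preadd) (E : bif X X) (A C A' C' : X)
    (e : E C A) (e' : E C' A') (PA : biproduct A A') (PC : biproduct C C') :
    E PC PA :=
  in1 PA *> (e <* pr1 PC) + in2 PA *> (e' <* pr2 PC).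

(* [real e s] means that the sequence [s] belongs to the equivalence class
   assigned to [e]; for [real e (Sequence B x y)] one usually writes
   s(e) = [A -x-> B -y-> C].  Since biproducts are only required to exist, the
   axioms mentioning direct sums range over all choices of them. *)
Record extcat := Extcat {
  extcat_addcat :> addcat;
  ext : bif extcat_addcat extcat_addcat;
  real : forall A C, ext C A -> sequence A C -> Prop;
  real_class : forall A C (e : ext C A),
    exists s, forall t, real e t <-> seq_equiv s t;
  real0 : forall A C (P : biproduct A C),
    real (0 : ext C A) (Sequence P (in1 P) (pr2 P));
  real_sum : forall A C A' C' (e : ext C A) (e' : ext C' A') s s'
      (PA : biproduct A A') (PM : biproduct (mid s) (mid s'))
      (PC : biproduct C C'),
    real e s -> real e' s' -> real (bif_sum e e' PA PC) (seq_sum s s' PA PM PC);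
  real_morph : forall A B C A' B' C' (e : ext C A) (e' : ext C' A')
      (x : hom A B) (y : hom B C) (x' : hom A' B') (y' : hom B' C')
      (a : hom A A') (c : hom C C'),
    real e (Sequence B x y) -> real e' (Sequence B' x' y') ->
    a *> e = e' <* c ->
    exists b : hom B B', b \c x = x' \c a /\ y' \c b = c \c y;
  et3 : forall A B C A' B' C' (e : ext C A) (e' : ext C' A')
      (x : hom A B) (y : hom B C) (x' : hom A' B') (y' : hom B' C')
      (a : hom A A') (b : hom B B'),
    real e (Sequence B x y) -> real e' (Sequence B' x' y') ->
    b \c x = x' \c a ->
    exists c : hom C C', c \c y = y' \c b /\ a *> e = e' <* c;
  et3op : forall A B C A' B' C' (e : ext C A) (e' : ext C' A')
      (x : hom A B) (y : hom B C) (x' : hom A' B') (y' : hom B' C')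
      (b : hom B B') (c : hom C C'),
    real e (Sequence B x y) -> real e' (Sequence B' x' y') ->
    c \c y = y' \c b ->
    exists a : hom A A', b \c x = x' \c a /\ a *> e = e' <* c;
  et4 : forall A B C D F (e : ext D A) (e' : ext F B)
      (f : hom A B) (f' : hom B D) (g : hom B C) (g' : hom C F),
    real e (Sequence B f f') -> real e' (Sequence C g g') ->
    exists (E : extcat_addcat) (e'' : ext E A) (h' : hom C E)
           (d : hom D E) (k : hom E F),
      [/\ real e'' (Sequence C (g \c f) h'),
          d \c f' = h' \c g /\ k \c h' = g',
          real (f' *> e') (Sequence E d k),
          e'' <* d = e &
          f *> e'' = e' <* k];
  et4op : forall A B C D F (e : ext A D) (e' : ext B F)
      (f : hom B A) (f' : hom D B) (g : hom C B) (g' : hom F C),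
    real e (Sequence B f' f) -> real e' (Sequence C g' g) ->
    exists (E : extcat_addcat) (e'' : ext A E) (h' : hom E C)
           (d : hom E D) (k : hom F E),
      [/\ real e'' (Sequence C h' (f \c g)),
          f' \c d = g \c h' /\ h' \c k = g',
          real (e' <* f') (Sequence E k d),
          d *> e'' = e &
          e'' <* f = k *> e']
}.
Arguments ext : clear implicits.

Definition seq_map (X Y : preadd) (F : functor X Y) (A C : X)
    (s : sequence A C) : sequence (F A) (F C) :=
  Sequence (F (mid s)) (fm F (seq_in s)) (fm F (seq_out s)).

Record extfun (C D : extcat) := Extfun {
  extfun_functor :> functor C D;
  gamma : btrans (ext C) (bif_reindex extfun_functor extfun_functor (ext D));
  gamma_real : forall A B (e : ext C B A) s,
    real e s -> real (bt gamma e) (seq_map extfun_functor s)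
}.
Arguments gamma {C D} F : rename.

Definition gammaE (C D : extcat) (F : extfun C D) (A B : C) (e : ext C A B) :
  ext D (F A) (F B) := bt (gamma F) e.

Definition gamma_id (C : extcat) :
  btrans (ext C) (bif_reindex (functor_id C) (functor_id C) (ext C)).
Proof.
by refine (@Btrans _ _ (ext C)
  (bif_reindex (functor_id C) (functor_id C) (ext C)) (fun A B e => e) _ _ _).
Defined.

Definition extfun_id (C : extcat) : extfun C C.
Proof. by exists (functor_id C) (gamma_id C) => A B e []. Defined.

Definition gamma_comp (B C D : extcat) (G : extfun C D) (F : extfun B C) :
  btrans (ext B) (bif_reindex (functor_comp G F) (functor_comp G F) (ext D)).
Proof.
exists (fun _ _ e => bt (gamma G) (bt (gamma F) e)).
- by move=> *; rewrite !btD.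
- by move=> *; rewrite !bt_pull.
- by move=> *; rewrite !bt_push.
Defined.

Definition extfun_comp (B C D : extcat) (G : extfun C D) (F : extfun B C) :
  extfun B D.
Proof.
exists (functor_comp G F) (gamma_comp G F) => X Y e s es.
exact: (gamma_real G (gamma_real F es)).
Defined.

Definition ext_nattrans (C D : extcat) (F H : extfun C D)
    (alpha : nattrans F H) :=
  forall (A B : C) (e : ext C A B),
    alpha B *> gammaE F e = gammaE H e <* alpha A.

Section Quotient.
Variables (V : zmodType) (R : V -> Prop).

(* membership in the subgroup generated by [R] *)
Definition span_pred : {pred V} := fun x =>
  `[< forall P : {pred V}, zmod_closed P -> (forall y, R y -> y \in P) ->
      x \in P >].

Lemma span_closed : zmod_closed span_pred.
Proof.
split; first by apply/asboolP => P [].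
move=> x y /asboolP Hx /asboolP Hy; apply/asboolP => P HP RP.
by case: (HP) => _; apply; [exact: Hx | exact: Hy].
Qed.

HB.instance Definition _ := GRing.isZmodClosed.Build V span_pred span_closed.

Definition quotz : zmodType := Quotient.quot span_pred.
Definition qproj (x : V) : quotz := \pi_(Quotient.quot span_pred) x.

Lemma qprojD x y : qproj (x + y) = qproj x + qproj y.
Proof. exact: (raddfD (\pi_(Quotient.quot span_pred))). Qed.

Lemma qprojB x y : qproj (x - y) = qproj x - qproj y.
Proof. exact: (raddfB (\pi_(Quotient.quot span_pred))). Qed.

Lemma qproj0 x : R x -> qproj x = 0.
Proof.
move=> Rx; rewrite -[0](raddf0 (\pi_(Quotient.quot span_pred))).
apply/eqP; rewrite -Quotient.idealrBE subr0.
by apply/asboolP => P _; apply.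
Qed.

(* the map induced by [f], provided [f] is additive and vanishes on [R] *)
Definition qlift (W : zmodType) (f : V -> W) (q : quotz) : W := f (repr q).

Section Lift.
Variables (W : zmodType) (f : V -> W).
Hypothesis fD : {morph f : x y / x + y}.
Hypothesis fR : forall x, R x -> f x = 0.

Lemma qlift_proj x : qlift f (qproj x) = f x.
Proof.
have f0 : f 0 = 0 by apply: (addrI (f 0)); rewrite -fD !addr0.
have fB y z : f (y - z) = f y - f z.
  by apply: (addIr (f z)); rewrite -fD !subrK.
apply/eqP; rewrite -subr_eq0 -fB.
have: repr (qproj x) - x \in span_pred.
  by rewrite Quotient.idealrBE reprK.
move/asboolP/(_ (fun y => f y == 0)); apply; last by move=> y /fR/eqP.
split; first exact/eqP.
by move=> y z /eqP fy /eqP fz; apply/eqP; rewrite fB fy fz subr0.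
Qed.
End Lift.

Lemma qproj_surj q : exists x, q = qproj x.
Proof. by exists (repr q); rewrite /qproj reprK. Qed.

Lemma qliftD (W : zmodType) (f : V -> W) :
  {morph f : x y / x + y} -> (forall x, R x -> f x = 0) ->
  {morph qlift f : x y / x + y}.
Proof.
move=> fD fR x y; have [x' ->] := qproj_surj x; have [y' ->] := qproj_surj y.
by rewrite -qprojD !qlift_proj.
Qed.

End Quotient.

Section FreeGroup.
Variables (K : choiceType) (W : zmodType).

Definition free_lift (f : K -> W) (x : {freeg K / int}) : W :=
  fglift (f : K -> zmodule W) x.

Lemma free_liftB f x y : free_lift f (x - y) = free_lift f x - free_lift f y.
Proof. exact: (lift_is_additive (f : K -> zmodule W)). Qed.

Lemma free_liftD f : {morph free_lift f : x y / x + y}.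
Proof.
move=> x y; have := free_liftB f (x + y) y.
by rewrite addrK => ->; rewrite subrK.
Qed.

Lemma free_liftU f k : free_lift f << k >> = f k.
Proof. by rewrite /free_lift liftU scale1r. Qed.

Lemma free_ext (f g : {freeg K / int} -> W) :
  {morph f : x y / x + y} -> {morph g : x y / x + y} ->
  (forall k, f << k >> = g << k >>) -> f =1 g.
Proof.
move=> fD gD fg x.
have H (h : {freeg K / int} -> W) : {morph h : x y / x + y} ->
    h x = \sum_(k <- dom x) h << k >> *~ coeff k x.
  move=> hD; have hB : zmod_morphism h.
    by move=> y z; apply: (addIr (h z)); rewrite -hD !subrK.
  pose hA : {additive {freeg K / int} -> W} :=
    HB.pack h (GRing.isZmodMorphism.Build _ _ h hB).
  rewrite -[in LHS](freeg_sumE x) -[h]/(hA : _ -> _) raddf_sum.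
  apply: eq_bigr => k _; rewrite -raddfMz; congr (hA _).
  by rewrite freegU_mulz intz.
by rewrite (H f) // (H g) //; apply: eq_bigr => k _; rewrite fg.
Qed.
End FreeGroup.

Section Tensor.
Variables V W : zmodType.

Definition tensor_rel (x : {freeg (V * W)%type / int}) : Prop :=
  (exists v v' w, x = << (v + v', w) >> - (<< (v, w) >> + << (v', w) >>)) \/
  (exists v w w', x = << (v, w + w') >> - (<< (v, w) >> + << (v, w') >>)).

Definition tensor : zmodType := quotz tensor_rel.
Definition tens (v : V) (w : W) : tensor := qproj tensor_rel << (v, w) >>.

Lemma tensDl v v' w : tens (v + v') w = tens v w + tens v' w.
Proof.
apply/eqP; rewrite -subr_eq0 -qprojD -qprojB; apply/eqP/qproj0.
by left; exists v, v', w.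
Qed.

Lemma tensDr v w w' : tens v (w + w') = tens v w + tens v w'.
Proof.
apply/eqP; rewrite -subr_eq0 -qprojD -qprojB; apply/eqP/qproj0.
by right; exists v, w, w'.
Qed.

Definition biadditive (M : zmodType) (b : V -> W -> M) :=
  (forall v v' w, b (v + v') w = b v w + b v' w) /\
  (forall v w w', b v (w + w') = b v w + b v w').

Definition tens_lift (M : zmodType) (b : V -> W -> M) : tensor -> M :=
  qlift (free_lift (fun p => b p.1 p.2)).

Lemma tens_lift_rel (M : zmodType) (b : V -> W -> M) : biadditive b ->
  forall x, tensor_rel x -> free_lift (fun p => b p.1 p.2) x = 0.
Proof.
case=> bl br x.
case=> [[v [v' [w ->]]]|[v [w [w' ->]]]];
by rewrite free_liftB free_liftD !free_liftU /= ?bl ?br subrr.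
Qed.

Lemma tens_liftE (M : zmodType) (b : V -> W -> M) v w :
  biadditive b -> tens_lift b (tens v w) = b v w.
Proof.
move=> bb; rewrite /tens_lift qlift_proj ?free_liftU //.
- exact: free_liftD.
- exact: tens_lift_rel.
Qed.

Lemma tens_liftD (M : zmodType) (b : V -> W -> M) :
  biadditive b -> {morph tens_lift b : x y / x + y}.
Proof.
by move=> bb; apply: qliftD; [exact: free_liftD | exact: tens_lift_rel].
Qed.

Lemma tens_ext (M : zmodType) (f g : tensor -> M) :
  {morph f : x y / x + y} -> {morph g : x y / x + y} ->
  (forall v w, f (tens v w) = g (tens v w)) -> f =1 g.
Proof.
move=> fD gD fg q; have [x ->] := qproj_surj q; move: x.
apply: (@free_ext _ _ (f \o @qproj _ _) (g \o @qproj _ _)).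
- by move=> x y /=; rewrite qprojD fD.
- by move=> x y /=; rewrite qprojD gD.
- by case=> v w; apply: fg.
Qed.
End Tensor.

Section DirectSum.
Variables (I : Type) (V : I -> zmodType).

(* The direct sum is presented as the abelian group generated by the disjoint
   union of the [V i], subject to the additivity relations within each [V i]. *)
Definition dsum_key (i : I) (v : V i) : {classic {i : I & V i}} :=
  existT (fun i => V i : Type) i v.

Definition dsum_rel (x : {freeg {classic {i : I & V i}} / int}) : Prop :=
  exists i (v v' : V i),
    x = << dsum_key (v + v') >> - (<< dsum_key v >> + << dsum_key v' >>).

Definition dsum : zmodType := quotz dsum_rel.
Definition dinj (i : I) (v : V i) : dsum := qproj dsum_rel << dsum_key v >>.

Lemma dinjD i (v v' : V i) : dinj (v + v') = dinj v + dinj v'.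
Proof.
apply/eqP; rewrite -subr_eq0 -qprojD -qprojB; apply/eqP/qproj0.
by exists i, v, v'.
Qed.

Definition dlift (M : zmodType) (f : forall i, V i -> M) : dsum -> M :=
  qlift (free_lift
    (fun k : {classic {i : I & V i}} => f (projT1 k) (projT2 k))).

Section Lift.
Variables (M : zmodType) (f : forall i, V i -> M).
Hypothesis fD : forall i, {morph @f i : x y / x + y}.

Lemma dlift_rel x : dsum_rel x -> free_lift
    (fun k : {classic {i : I & V i}} => f (projT2 k)) x = 0.
Proof.
by case=> i [v [v' ->]]; rewrite free_liftB free_liftD !free_liftU /= fD subrr.
Qed.

Lemma dliftE i (v : V i) : dlift f (dinj v) = f v.
Proof.
rewrite /dlift qlift_proj ?free_liftU //.
- exact: free_liftD.
- exact: dlift_rel.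
Qed.

Lemma dliftD : {morph dlift f : x y / x + y}.
Proof. by apply: qliftD; [exact: free_liftD | exact: dlift_rel]. Qed.
End Lift.

Lemma dsum_ext (M : zmodType) (f g : dsum -> M) :
  {morph f : x y / x + y} -> {morph g : x y / x + y} ->
  (forall i (v : V i), f (dinj v) = g (dinj v)) -> f =1 g.
Proof.
move=> fD gD fg q; have [x ->] := qproj_surj q; move: x.
apply: (@free_ext _ _ (f \o @qproj _ _) (g \o @qproj _ _)).
- by move=> x y /=; rewrite qprojD fD.
- by move=> x y /=; rewrite qprojD gD.
- by case=> i v; apply: (fg i v).
Qed.
End DirectSum.

(* A set |X| of representatives of the isomorphism classes of objects.  The
   essential smallness of [X] is the existence of such a [skel], which lives
   in the universe of the abelian groups, unlike [X] itself. *)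
Record skeleton (X : preadd) := Skeleton {
  skel : Type;
  rep : skel -> X;
  rep_surj : forall A : X, exists c, isomorphic A (rep c);
  rep_inj : forall c c', isomorphic (rep c) (rep c') -> c = c'
}.

Section Yoneda.
Variables (X : preadd) (K : skeleton X) (E G : bif X X).

Definition yoneda_sum (A B : X) : zmodType :=
  dsum (fun c : skel K => tensor (E (rep c) B) (G A (rep c))).

Definition yoneda_rel (A B : X) (x : yoneda_sum A B) : Prop :=
  exists (c c' : skel K) (e : E (rep c) B) (e' : G A (rep c'))
         (f : hom (rep c') (rep c)),
    x = dinj (i := c') (tens (e <* f) e') - dinj (i := c) (tens e (f *> e')).

Definition yoneda_ob (A B : X) : zmodType := quotz (@yoneda_rel A B).

Definition ygen (A B : X) (c : skel K) (e : E (rep c) B) (e' : G A (rep c)) :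
    yoneda_ob A B :=
  qproj _ (dinj (i := c) (tens e e')).

Lemma ygenDl A B c (e1 e2 : E (rep c) B) (e' : G A (rep c)) :
  ygen (e1 + e2) e' = ygen e1 e' + ygen e2 e'.
Proof. by rewrite /ygen tensDl dinjD qprojD. Qed.

Lemma ygenDr A B c (e : E (rep c) B) (e1 e2 : G A (rep c)) :
  ygen e (e1 + e2) = ygen e e1 + ygen e e2.
Proof. by rewrite /ygen tensDr dinjD qprojD. Qed.

Lemma ygen_bal A B c c' (e : E (rep c) B) (e' : G A (rep c'))
    (f : hom (rep c') (rep c)) : ygen (e <* f) e' = ygen e (f *> e').
Proof.
apply/eqP; rewrite -subr_eq0 -qprojB; apply/eqP/qproj0.
by exists c, c', e, e', f.
Qed.

Lemma yoneda_ext A B (M : zmodType) (f g : yoneda_ob A B -> M) :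
  {morph f : x y / x + y} -> {morph g : x y / x + y} ->
  (forall c (e : E (rep c) B) (e' : G A (rep c)),
     f (ygen e e') = g (ygen e e')) -> f =1 g.
Proof.
move=> fD gD fg q; have [x ->] := qproj_surj q; move: x.
apply: (@dsum_ext _ _ _ (f \o @qproj _ _) (g \o @qproj _ _)).
- by move=> x y /=; rewrite qprojD fD.
- by move=> x y /=; rewrite qprojD gD.
move=> c; apply: (@tens_ext _ _ _ (fun t => f (qproj _ (dinj (i := c) t)))
                                  (fun t => g (qproj _ (dinj (i := c) t)))).
- by move=> x y; rewrite dinjD qprojD fD.
- by move=> x y; rewrite dinjD qprojD gD.
- exact: fg.
Qed.

Definition balanced (A B : X) (M : zmodType)
    (b : forall c : skel K, E (rep c) B -> G A (rep c) -> M) :=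
  (forall c, biadditive (b c)) /\
  (forall c c' (e : E (rep c) B) (e' : G A (rep c')) (f : hom (rep c') (rep c)),
     b c' (e <* f) e' = b c e (f *> e')).

Definition ylift (A B : X) (M : zmodType)
    (b : forall c : skel K, E (rep c) B -> G A (rep c) -> M) :
    yoneda_ob A B -> M :=
  qlift (dlift (fun c => tens_lift (b c))).

Section Lift.
Variables (A B : X) (M : zmodType).
Variable b : forall c : skel K, E (rep c) B -> G A (rep c) -> M.
Hypothesis bb : balanced b.

Let liftD := dliftD (fun c => tens_liftD (proj1 bb c)).

Lemma ylift_rel x : yoneda_rel x -> dlift (fun c => tens_lift (b (c := c))) x = 0.
Proof.
case=> c [c' [e [e' [f ->]]]]; set h := dlift _.
have hB y z : h (y - z) = h y - h z.
  by apply: (addIr (h z)); rewrite -liftD !subrK.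
rewrite hB /h !dliftE; try by move=> i; exact: (tens_liftD (proj1 bb i)).
by rewrite !tens_liftE ?(proj2 bb) ?subrr //; exact: (proj1 bb).
Qed.

Lemma yliftD : {morph ylift b : x y / x + y}.
Proof. by apply: qliftD; [exact: liftD | exact: ylift_rel]. Qed.

Lemma yliftE c (e : E (rep c) B) (e' : G A (rep c)) :
  ylift b (ygen e e') = b e e'.
Proof.
rewrite /ylift /ygen qlift_proj; [|exact: liftD|exact: ylift_rel].
rewrite dliftE ?tens_liftE //; first exact: (proj1 bb).
by move=> i; exact: (tens_liftD (proj1 bb i)).
Qed.
End Lift.

Definition yoneda_pull A A' B (x : yoneda_ob A B) (g : hom A' A) :
    yoneda_ob A' B :=
  ylift (fun c (e : E (rep c) B) (e' : G A (rep c)) => ygen e (e' <* g)) x.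

Definition yoneda_push A B B' (f : hom B B') (x : yoneda_ob A B) :
    yoneda_ob A B' :=
  ylift (fun c (e : E (rep c) B) (e' : G A (rep c)) => ygen (f *> e) e') x.

Lemma pull_balanced A A' B (g : hom A' A) : balanced
  (fun c (e : E (rep c) B) (e' : G A (rep c)) => ygen e (e' <* g)).
Proof.
split=> [c|c c' e e' f]; last by rewrite ygen_bal push_pull.
by split=> *; rewrite ?pullD (ygenDl, ygenDr).
Qed.

Lemma push_balanced A B B' (f : hom B B') : balanced
  (fun c (e : E (rep c) B) (e' : G A (rep c)) => ygen (f *> e) e').
Proof.
split=> [c|c c' e e' g]; last by rewrite push_pull ygen_bal.
by split=> *; rewrite ?pushD (ygenDl, ygenDr).
Qed.

Lemma yoneda_pullE A A' B (g : hom A' A) c (e : E (rep c) B)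
  (e' : G A (rep c)) : yoneda_pull (ygen e e') g = ygen e (e' <* g).
Proof. by rewrite /yoneda_pull yliftE //; exact: pull_balanced. Qed.

Lemma yoneda_pushE A B B' (f : hom B B') c (e : E (rep c) B)
  (e' : G A (rep c)) : yoneda_push f (ygen e e') = ygen (f *> e) e'.
Proof. by rewrite /yoneda_push yliftE //; exact: push_balanced. Qed.

Lemma yoneda_pullD A A' B (g : hom A' A) (x y : yoneda_ob A B) :
  yoneda_pull (x + y) g = yoneda_pull x g + yoneda_pull y g.
Proof. apply: yliftD; apply: pull_balanced. Qed.

Lemma yoneda_pushD A B B' (f : hom B B') (x y : yoneda_ob A B) :
  yoneda_push f (x + y) = yoneda_push f x + yoneda_push f y.
Proof. apply: yliftD; apply: push_balanced. Qed.

(* [yoneda] sends [(A, B)] to the quotient of the direct sum of the groups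
   [E(c, B) (x) G(A, c)], [c] in [K], by the balancing relations. *)
Definition yoneda : bif X X.
Proof.
exists yoneda_ob yoneda_pull yoneda_push.
- by move=> A A' B e e' f; apply: yoneda_pullD.
- by move=> A B B' f e e'; apply: yoneda_pushD.
- move=> A A' B x f f'; move: x; apply: yoneda_ext.
  + by move=> x y; exact: yoneda_pullD.
  + by move=> x y; rewrite (yoneda_pullD f) (yoneda_pullD f') addrACA.
  + by move=> c e e'; rewrite !yoneda_pullE pullDr ygenDr.
- move=> A B B' f f'; apply: yoneda_ext.
  + by move=> x y; exact: yoneda_pushD.
  + by move=> x y; rewrite (yoneda_pushD f) (yoneda_pushD f') addrACA.
  + by move=> c e e'; rewrite !yoneda_pushE pushDl ygenDl.
- move=> A B; apply: yoneda_ext => //; first by move=> x y; exact: yoneda_pullD.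
  by move=> c e e'; rewrite yoneda_pullE pull1.
- move=> A B; apply: yoneda_ext => //; first by move=> x y; exact: yoneda_pushD.
  by move=> c e e'; rewrite yoneda_pushE push1.
- move=> A A' A'' B x f g; move: x; apply: yoneda_ext.
  + by move=> x y; exact: yoneda_pullD.
  + by move=> x y; rewrite !yoneda_pullD.
  + by move=> c e e'; rewrite !yoneda_pullE pullM.
- move=> A B B' B'' g f; apply: yoneda_ext.
  + by move=> x y; exact: yoneda_pushD.
  + by move=> x y; rewrite !yoneda_pushD.
  + by move=> c e e'; rewrite !yoneda_pushE pushM.
- move=> A A' B B' f x g; move: x; apply: yoneda_ext.
  + by move=> x y; rewrite yoneda_pullD yoneda_pushD.
  + by move=> x y; rewrite yoneda_pushD yoneda_pullD.
  + by move=> c e e'; rewrite yoneda_pushE !yoneda_pullE yoneda_pushE.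
Defined.

Lemma ygen_pull A A' B c (e : E (rep c) B) (e' : G A (rep c)) (g : hom A' A) :
  pull yoneda (ygen e e') g = ygen e (e' <* g).
Proof. exact: yoneda_pullE. Qed.

Lemma ygen_push A B B' c (e : E (rep c) B) (e' : G A (rep c)) (f : hom B B') :
  push yoneda f (ygen e e') = ygen (f *> e) e'.
Proof. exact: yoneda_pushE. Qed.

Record to_rep_data (C : X) := ToRep {
  tr_rep : skel K;
  tr_to : hom C (rep tr_rep);
  tr_from : hom (rep tr_rep) C;
  tr_inv : inverse_pair tr_to tr_from
}.

Definition to_rep (C : X) : to_rep_data C :=
  let: exist c isoc := cid (rep_surj K C) in
  let: exist u isou := cid isoc in
  let: exist v uv := cid isou in
  ToRep uv.

(* the product of [e : E(C, B)] and [e' : G(A, C)] over an arbitrary object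
   [C], computed by moving [C] to its representative *)
Definition yprod (A B C : X) (e : E C B) (e' : G A C) : yoneda A B :=
  let: ToRep c u v _ := to_rep C in ygen (e <* v) (u *> e').

Lemma yprodDl A B C (e1 e2 : E C B) (e' : G A C) :
  yprod (e1 + e2) e' = yprod e1 e' + yprod e2 e'.
Proof. by rewrite /yprod; case: to_rep => c u v _; rewrite pullD ygenDl. Qed.

Lemma yprodDr A B C (e : E C B) (e1 e2 : G A C) :
  yprod e (e1 + e2) = yprod e e1 + yprod e e2.
Proof. by rewrite /yprod; case: to_rep => c u v _; rewrite pushD ygenDr. Qed.

Lemma yprod_bal A B C C' (e : E C B) (e' : G A C') (f : hom C' C) :
  yprod (e <* f) e' = yprod e (f *> e').
Proof.
rewrite /yprod; case: (to_rep C') => c' u' v' [vu' _].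
case: (to_rep C) => c u v [vu _].
have -> : (e <* f) <* v' = (e <* v) <* (u \c f \c v').
  by rewrite -!pullM !compA vu comp1m.
have -> : u *> f *> e' = (u \c f \c v') *> u' *> e'.
  by rewrite -!pushM -!compA vu' compm1.
exact: ygen_bal.
Qed.

Lemma yprod_pull A A' B C (e : E C B) (e' : G A C) (g : hom A' A) :
  yprod e e' <* g = yprod e (e' <* g).
Proof.
by rewrite /yprod; case: to_rep => c u v _; rewrite ygen_pull push_pull.
Qed.

Lemma yprod_push A B B' C (f : hom B B') (e : E C B) (e' : G A C) :
  f *> yprod e e' = yprod (f *> e) e'.
Proof.
by rewrite /yprod; case: to_rep => c u v _; rewrite ygen_push push_pull.
Qed.

Lemma yprod_balanced A B :
  balanced (fun c (e : E (rep c) B) (e' : G A (rep c)) => yprod e e').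
Proof.
split=> [c|c c' e e' f]; last exact: yprod_bal.
by split=> *; [exact: yprodDl | exact: yprodDr].
Qed.

End Yoneda.

Section YonedaMap.
Variables (X Y : preadd) (F : functor X Y) (KX : skeleton X) (KY : skeleton Y).
Variables (E G : bif X X) (E' G' : bif Y Y).
Variables (m : btrans E (bif_reindex F F E')) (m' : btrans G (bif_reindex F F G')).

Let b A B (c : skel KX) (e : E (rep c) B) (e' : G A (rep c)) :
    yoneda KY E' G' (F A) (F B) :=
  yprod KY (bt m e : E' _ _) (bt m' e' : G' _ _).

Lemma yoneda_map_balanced A B : balanced (@b A B).
Proof.
split=> [c|c c' e e' f]; rewrite /b.
  by split=> *; rewrite btD (yprodDl, yprodDr).
by rewrite bt_pull bt_push; apply: yprod_bal.
Qed.

Definition yoneda_map_fun A B (x : yoneda KX E G A B) :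
  yoneda KY E' G' (F A) (F B) := ylift (@b A B) x.

Lemma yoneda_map_funD A B (x y : yoneda KX E G A B) :
  yoneda_map_fun (x + y) = yoneda_map_fun x + yoneda_map_fun y.
Proof. by apply: yliftD; apply: yoneda_map_balanced. Qed.

Lemma yoneda_map_funE A B c (e : E (rep c) B) (e' : G A (rep c)) :
  yoneda_map_fun (ygen e e') = b e e'.
Proof. by apply: yliftE; apply: yoneda_map_balanced. Qed.

Lemma yoneda_map_fun_pull A A' B (x : yoneda KX E G A B) (f : hom A' A) :
  yoneda_map_fun (x <* f) = yoneda_map_fun x <* fm F f.
Proof.
move: x; apply: yoneda_ext.
- by move=> x y; rewrite pullD yoneda_map_funD.
- by move=> x y; rewrite yoneda_map_funD pullD.
- move=> c e e'; rewrite ygen_pull !yoneda_map_funE /b bt_pull.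
  by rewrite yprod_pull.
Qed.

Lemma yoneda_map_fun_push A B B' (f : hom B B') (x : yoneda KX E G A B) :
  yoneda_map_fun (f *> x) = fm F f *> yoneda_map_fun x.
Proof.
move: x; apply: yoneda_ext.
- by move=> x y; rewrite pushD yoneda_map_funD.
- by move=> x y; rewrite yoneda_map_funD pushD.
- move=> c e e'; rewrite ygen_push !yoneda_map_funE /b bt_push.
  by rewrite yprod_push.
Qed.

Definition yoneda_map :
    btrans (yoneda KX E G) (bif_reindex F F (yoneda KY E' G')) :=
  @Btrans _ _ (yoneda KX E G) (bif_reindex F F (yoneda KY E' G'))
    yoneda_map_fun yoneda_map_funD yoneda_map_fun_pull yoneda_map_fun_push.

Lemma yoneda_mapE A B c (e : E (rep c) B) (e' : G A (rep c)) :
  bt yoneda_map (ygen e e') = yprod KY (bt m e : E' _ _) (bt m' e' : G' _ _).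
Proof. exact: yoneda_map_funE. Qed.

Lemma yoneda_map_prod A B C (e : E C B) (e' : G A C) :
  bt yoneda_map (yprod KX e e') = yprod KY (bt m e : E' _ _) (bt m' e' : G' _ _).
Proof.
rewrite [in LHS]/yprod; case: (to_rep KX C) => c u v [vu _].
rewrite yoneda_mapE bt_pull bt_push.
transitivity (yprod KY ((bt m e : E' _ _) <* fm F v)
                       (fm F u *> (bt m' e' : G' _ _))) => //.
by rewrite -yprod_bal -pullM -fmM vu fm1 pull1.
Qed.

End YonedaMap.

Section HigherExtensions.
Variables (C : extcat) (K : skeleton C).

(* [hext_succ n] is E^(n+1) *)
Fixpoint hext_succ (n : nat) : bif C C :=
  if n is m.+1 then yoneda K (ext C) (hext_succ m) else ext C.

(* [hext n] is E^n for n >= 1; the value at [0] is irrelevant *)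
Definition hext (n : nat) : bif C C := hext_succ n.-1.

End HigherExtensions.

(* [hgamma F n] is Gamma_F^n for n >= 1, determined by Gamma_F^1 = Gamma_F and
   Gamma_F^(n+1)(e . e') = Gamma_F(e) . Gamma_F^n(e'), see [yoneda_map_prod]. *)
Section HigherGamma.
Variables (C D : extcat) (KC : skeleton C) (KD : skeleton D) (F : extfun C D).

Fixpoint hgamma_succ (n : nat) :
    btrans (hext_succ KC n) (bif_reindex F F (hext_succ KD n)) :=
  if n is m.+1 then yoneda_map KC KD (gamma F) (hgamma_succ m) else gamma F.

Definition hgamma (n : nat) :
  btrans (hext KC n) (bif_reindex F F (hext KD n)) := hgamma_succ n.-1.

Definition hgammaE (n : nat) (A B : C) (e : hext KC n A B) :
  hext KD n (F A) (F B) := bt (hgamma n) e.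

Lemma hgammaD n A B (e e' : hext KC n A B) :
  hgammaE (e + e') = hgammaE e + hgammaE e'.
Proof. exact: (btD (hgamma n)). Qed.

Lemma hgamma_pull n A A' B (e : hext KC n A B) (f : hom A' A) :
  hgammaE (e <* f) = hgammaE e <* fm F f.
Proof. exact: (bt_pull (hgamma n)). Qed.

Lemma hgamma_push n A B B' (f : hom B B') (e : hext KC n A B) :
  hgammaE (f *> e) = fm F f *> hgammaE e.
Proof. exact: (bt_push (hgamma n)). Qed.

End HigherGamma.

(* [S] is left adjoint to [T], with unit [phi] and counit [psi] *)
Definition adjoint_pair (C D : preadd) (S : functor D C) (T : functor C D)
    (phi : nattrans (functor_id D) (functor_comp T S))
    (psi : nattrans (functor_comp S T) (functor_id C)) :=
  (forall A : D, psi (S A) \c fm S (phi A) = idm (S A)) /\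
  (forall A : C, fm T (psi A) \c phi (T A) = idm (T A)).

Section TauSigma.
Variables (C D : extcat) (KC : skeleton C) (KD : skeleton D).
Variables (S : extfun D C) (T : extfun C D) (n : nat).

(* the bifunctors E^n(S(?), -) and F^n(?, T(-)) on D^op * C *)
Definition hext_S : bif D C := bif_reindex S (functor_id C) (hext KC n).
Definition hext_T : bif D C := bif_reindex (functor_id D) T (hext KD n).

Section Tau.
Variable phi : nattrans (extfun_id D) (extfun_comp T S).

Definition tau_fun (A : D) (B : C) (e : hext KC n (S A) B) :
  hext KD n A (T B) := hgammaE KD T e <* phi A.

Definition tau : btrans hext_S hext_T.
Proof.
refine (@Btrans _ _ hext_S hext_T tau_fun _ _ _).
- by move=> A B e e'; rewrite /tau_fun hgammaD pullD.
- move=> A A' B e f; rewrite /tau_fun /= hgamma_pull -!pullM.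
  by congr (_ <* _); rewrite -(nt_nat phi).
- by move=> A B B' f e; rewrite /tau_fun /= hgamma_push push_pull.
Defined.
End Tau.

Section Sigma.
Variable psi : nattrans (extfun_comp S T) (extfun_id C).

Definition sigma_fun (A : D) (B : C) (e : hext KD n A (T B)) :
  hext KC n (S A) B := psi B *> hgammaE KC S e.

Definition sigma : btrans hext_T hext_S.
Proof.
refine (@Btrans _ _ hext_T hext_S sigma_fun _ _ _).
- by move=> A B e e'; rewrite /sigma_fun hgammaD pushD.
- by move=> A A' B e f; rewrite /sigma_fun /= hgamma_pull push_pull.
- move=> A B B' f e; rewrite /sigma_fun /= hgamma_push -!pushM.
  by congr (_ *> _); rewrite -(nt_nat psi).
Defined.
End Sigma.

End TauSigma.

(* Main.v *)
Require Import Defs.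
From mathcomp Require Import all_boot.

Set Implicit Arguments.
Unset Strict Implicit.
Unset Printing Implicit Defensive.

Local Open Scope cat_scope.

(** The maps tau and sigma copy the usual adjunction bijection: for a higher
    extension [e] in F^n(D, TC), naturality of Gamma_T^n gives

      tau (sigma e) = T(psi_C) . Gamma_T^n (Gamma_S^n e) . phi_D.

    If [phi] is compatible with Gamma^n, then [phi_D] can be moved across the
    extension, where it becomes [phi_(TC)], and the triangle identity
    [T(psi_C) . phi_(TC) = 1] leaves [e].  Symmetrically, if [psi] is
    compatible with Gamma^n, then sigma (tau e) = e by the other triangle
    identity.  So the retraction of one map is always the other one.

    The hypotheses give compatibility only for n = 1.  It passes to every n
    ([hgamma_nattrans]) because Gamma^n is multiplicative and a product of
    extensions is balanced: the component of the transformation at the middle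
    object slides from the left factor to the right one.  For this to apply to
    the unit and the counit, F |-> Gamma_F^n must also respect identities
    ([hgamma_id]) and composites ([hgamma_comp]). *)

(** Both sides are products over the same object; the chosen isomorphism from
    [rep c] to its representative is absorbed by balancing. *)
Lemma yprod_rep (X : preadd) (K : skeleton X) (E G : bif X X) (A B : X)
    (c : skel K) (e : E (rep c) B) (e' : G A (rep c)) :
  yprod K e e' = ygen e e'.
Proof.
rewrite /yprod; case: (to_rep K (rep c)) => d u v [vu _].
by rewrite ygen_bal -pushM vu push1.
Qed.

(** The identity functor sends the generator [ygen e e'] to [yprod K e e'], a
    priori a different element, so [yprod_rep] is what closes the induction. *)
Lemma hgamma_id (C : extcat) (K : skeleton C) (n : nat) (A B : C)
    (e : hext K n A B) : hgammaE K (extfun_id C) e = e.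
Proof.
rewrite /hgammaE /hgamma; rewrite /hext in e *; move: n.-1 A B e => {n}.
elim=> [//|n IHn] A B; apply: yoneda_ext => //.
- exact: (btD (hgamma_succ K K (extfun_id C) n.+1)).
- move=> c e e'; rewrite [LHS]yoneda_mapE IHn; exact: yprod_rep.
Qed.

(** The image of a generator under [F] is a product over [F (rep c)], which need
    not be one of the chosen representatives; [yoneda_map_prod] still computes
    its image under [G]. *)
Lemma hgamma_comp (B C D : extcat) (KB : skeleton B) (KC : skeleton C)
    (KD : skeleton D) (G : extfun C D) (F : extfun B C) (n : nat) (X Y : B)
    (e : hext KB n X Y) :
  hgammaE KD (extfun_comp G F) e = hgammaE KD G (hgammaE KC F e).
Proof.
rewrite /hgammaE /hgamma; rewrite /hext in e *; move: n.-1 X Y e => {n}.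
elim=> [//|n IHn] X Y; apply: yoneda_ext.
- exact: (btD (hgamma_succ KB KD (extfun_comp G F) n.+1)).
- move=> x y; rewrite [in LHS](btD (hgamma_succ KB KC F n.+1)).
  exact: (btD (hgamma_succ KC KD G n.+1)).
- move=> c e e'; rewrite [LHS]yoneda_mapE IHn [in RHS]yoneda_mapE.
  by rewrite [RHS]yoneda_map_prod.
Qed.

(** On a product [e . e'] with middle object [c], the induction step is the chain

      alpha_B . (F e . F e') = (H e . alpha_c) . F e' = H e . (alpha_c . F e')
                             = (H e . H e') . alpha_A,

    where [F e] stands for the image of [e] under the appropriate Gamma_F^k,
    and likewise for [H]. *)
Lemma hgamma_nattrans (C D : extcat) (KC : skeleton C) (KD : skeleton D)
    (F H : extfun C D) (alpha : nattrans F H) (n : nat) (A B : C)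
    (e : hext KC n A B) :
  ext_nattrans alpha ->
  alpha B *> hgammaE KD F e = hgammaE KD H e <* alpha A.
Proof.
move=> ext_alpha.
rewrite /hgammaE /hgamma; rewrite /hext in e *; move: n.-1 A B e => {n}.
elim=> [|n IHn] A B; first exact: ext_alpha.
apply: yoneda_ext.
- by move=> x y; rewrite (btD (hgamma_succ KC KD F n.+1)) pushD.
- by move=> x y; rewrite (btD (hgamma_succ KC KD H n.+1)) pullD.
- move=> c e e'; rewrite !yoneda_mapE yprod_push yprod_pull.
  have /= -> := ext_alpha _ _ e.
  by rewrite yprod_bal IHn.
Qed.

Lemma tau_sigmaK (C D : extcat) (KC : skeleton C) (KD : skeleton D)
    (S : extfun D C) (T : extfun C D)
    (phi : nattrans (extfun_id D) (extfun_comp T S))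
    (psi : nattrans (extfun_comp S T) (extfun_id C)) (n : nat) :
  adjoint_pair phi psi -> ext_nattrans phi ->
  btrans_retraction (sigma KC KD n psi) (tau KC KD n phi).
Proof.
move=> adj ext_phi A B e; rewrite /= /tau_fun /sigma_fun hgamma_push.
rewrite -push_pull -hgamma_comp -[X in _ *> X](hgamma_nattrans KD e ext_phi).
rewrite hgamma_id -pushM.
by have /= -> := proj2 adj B; rewrite push1.
Qed.

Lemma sigma_tauK (C D : extcat) (KC : skeleton C) (KD : skeleton D)
    (S : extfun D C) (T : extfun C D)
    (phi : nattrans (extfun_id D) (extfun_comp T S))
    (psi : nattrans (extfun_comp S T) (extfun_id C)) (n : nat) :
  adjoint_pair phi psi -> ext_nattrans psi ->
  btrans_retraction (tau KC KD n phi) (sigma KC KD n psi).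
Proof.
move=> adj ext_psi A B e; rewrite /= /tau_fun /sigma_fun hgamma_pull.
rewrite push_pull -hgamma_comp [X in X <* _](hgamma_nattrans KC e ext_psi).
rewrite hgamma_id -pullM.
by have /= -> := proj1 adj A; rewrite pull1.
Qed.

Theorem propositionA13 (C D : extcat) (KC : skeleton C) (KD : skeleton D)
    (S : extfun D C) (T : extfun C D)
    (phi : nattrans (extfun_id D) (extfun_comp T S))
    (psi : nattrans (extfun_comp S T) (extfun_id C))
    (adj : adjoint_pair phi psi) (n : nat) (n_ge1 : 1 <= n) :
  let tau_n := tau KC KD n phi in
  let sigma_n := sigma KC KD n psi in
  [/\ ext_nattrans phi -> split_mono sigma_n /\ split_epi tau_n,
      ext_nattrans psi -> split_mono tau_n /\ split_epi sigma_n
    & ext_nattrans phi -> ext_nattrans psi -> btrans_inverse tau_n sigma_n].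
Proof.
move=> tau_n sigma_n.
have tauK := @tau_sigmaK _ _ KC KD _ _ _ _ n adj.
have sigmaK := @sigma_tauK _ _ KC KD _ _ _ _ n adj.
split.
- by move=> /tauK rK; split; [exists tau_n | exists sigma_n].
- by move=> /sigmaK rK; split; [exists sigma_n | exists tau_n].
- by move=> /tauK rK /sigmaK rK'; split.
Qed.
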